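(* There are no minimal translation surfaces $X:I\times J\to\mathbb{S}^3$, $X(s,t)=\alpha(s)\cdot\beta(t)$ ($\alpha,\beta$ arc length curves in $\mathbb{S}^3$), with $\kappa_\alpha\equiv C\in\mathbb{R}$, $C\neq0$, and $\tau_\alpha=1$.
   Context: $\mathbb{R}^4$ is identified with the quaternions, ''$\cdot$'' is quaternion multiplication, and $\mathbb{S}^3$ is the group of unit quaternions with the induced metric. A translation surface is a regular surface locally parametrized by $X(s,t)=\alpha(s)\cdot\beta(t)$. For an arc length curve $\gamma$ in $\mathbb{S}^3$: $t_\gamma=\gamma'$, $\kappa_\gamma=|\nabla_{\gamma'}\gamma'|$; where $\kappa_\gamma\neq0$, $n_\gamma=\kappa_\gamma^{-1}\nabla_{\gamma'}\gamma'$, $b_\gamma\in T_\gamma\mathbb{S}^3$ is the unit vector orthogonal to $t_\gamma,n_\gamma$ with $\det(\gamma,t_\gamma,n_\gamma,b_\gamma)>0$, and the torsion $\tau_\gamma$ is defined by $\nabla_{t_\gamma}n_\gamma=-\kappa_\gamma t_\gamma+\tau_\gamma b_\gamma$. Minimal means the mean curvature in $\mathbb{S}^3$ vanishes identically. *)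

(* Defs.v *)
From HB Require Import structures.
From mathcomp Require Import all_boot all_order all_algebra.
From mathcomp Require Import all_classical all_reals all_analysis.

Set Implicit Arguments.
Unset Strict Implicit.
Unset Printing Implicit Defensive.

Import Order.TTheory GRing.Theory Num.Theory.
Import numFieldNormedType.Exports.

Local Open Scope classical_set_scope.
Local Open Scope ring_scope.

(* The quaternion a + b i + c j + d k is the row vector (a, b, c, d). *)
Definition quat (R : realType) (a b c d : R) : 'rV[R]_4 :=
  \row_(i < 4) [:: a; b; c; d]`_i.

Definition qmul (R : realType) (p q : 'rV[R]_4) : 'rV[R]_4 :=
  quat
    (p 0 0 * q 0 0 - p 0 1 * q 0 1 - p 0 2 * q 0 2 - p 0 3 * q 0 3)
    (p 0 0 * q 0 1 + p 0 1 * q 0 0 + p 0 2 * q 0 3 - p 0 3 * q 0 2)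
    (p 0 0 * q 0 2 - p 0 1 * q 0 3 + p 0 2 * q 0 0 + p 0 3 * q 0 1)
    (p 0 0 * q 0 3 + p 0 1 * q 0 2 - p 0 2 * q 0 1 + p 0 3 * q 0 0).

Definition dot (R : realType) (u v : 'rV[R]_4) : R := \sum_(i < 4) u 0 i * v 0 i.

(* MathComp-Analysis equips 'rV_4 with the sup norm, hence a separate Euclidean
   norm; both induce the same topology, so derivatives are the usual ones. *)
Definition enorm (R : realType) (u : 'rV[R]_4) : R := Num.sqrt (dot u u).

Definition sphere3 (R : realType) : set 'rV[R]_4 := [set p | enorm p = 1].

Definition det4 (R : realType) (u v w z : 'rV[R]_4) : R :=
  \det (\matrix_(i < 4) [:: u; v; w; z]`_i).

Definition open_interval (R : realType) (I : set R) : Prop :=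
  [/\ open I, is_interval I & I !=set0].

(* Curves are total functions, constrained only on the open interval I. *)
Definition smooth_on (R : realType) (I : set R) (g : R -> 'rV[R]_4) : Prop :=
  forall (n : nat) (s : R), I s -> derivable (derive1n n g) s 1.

Definition arclength_curve (R : realType) (I : set R) (g : R -> 'rV[R]_4) : Prop :=
  [/\ smooth_on I g,
      forall s, I s -> sphere3 (g s)
    & forall s, I s -> enorm (derive1 g s) = 1].

(* Orthogonal projection of R^4 onto the tangent space of S^3 at p. *)
Definition tproj (R : realType) (p v : 'rV[R]_4) : 'rV[R]_4 := v - dot v p *: p.

(* Levi-Civita covariant derivative in S^3, along the curve g, of a vector
   field V tangent to S^3 along g. *)
Definition covD (R : realType) (g V : R -> 'rV[R]_4) (s : R) : 'rV[R]_4 :=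
  tproj (g s) (derive1 V s).

Definition curvature (R : realType) (g : R -> 'rV[R]_4) (s : R) : R :=
  enorm (covD g (derive1 g) s).

Definition frenet_n (R : realType) (g : R -> 'rV[R]_4) (s : R) : 'rV[R]_4 :=
  (curvature g s)^-1 *: covD g (derive1 g) s.

(* These conditions determine b when g is an arc length curve in S^3 and
   curvature g s != 0. *)
Definition is_binormal (R : realType) (g : R -> 'rV[R]_4) (s : R)
    (b : 'rV[R]_4) : Prop :=
  [/\ enorm b = 1, dot b (g s) = 0, dot b (derive1 g s) = 0,
      dot b (frenet_n g s) = 0
    & 0 < det4 (g s) (derive1 g s) (frenet_n g s) b].

Definition has_torsion (R : realType) (g : R -> 'rV[R]_4) (s tau : R) : Prop :=
  curvature g s != 0 /\
  exists2 b : 'rV[R]_4, is_binormal g s b &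
    covD g (frenet_n g) s = - (curvature g s *: derive1 g s) + tau *: b.

Definition pd1 (R : realType) (X : R -> R -> 'rV[R]_4) (s t : R) : 'rV[R]_4 :=
  derive1 (fun s' => X s' t) s.

Definition pd2 (R : realType) (X : R -> R -> 'rV[R]_4) (s t : R) : 'rV[R]_4 :=
  derive1 (fun t' => X s t') t.

Definition regular_at (R : realType) (X : R -> R -> 'rV[R]_4) (s t : R) : Prop :=
  row_free (col_mx (pd1 X s t) (pd2 X s t)).

(* Unit normal at X s t of the surface inside S^3; it is unique up to sign
   where X is regular. *)
Definition is_unit_normal (R : realType) (X : R -> R -> 'rV[R]_4) (s t : R)
    (nu : 'rV[R]_4) : Prop :=
  [/\ enorm nu = 1, dot nu (X s t) = 0,
      dot nu (pd1 X s t) = 0 & dot nu (pd2 X s t) = 0].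

(* Half the trace of the second fundamental form of X in S^3 with respect to
   the unit normal nu: (e G - 2 f F + g E) / (2 (E G - F^2)). *)
Definition mean_curvature (R : realType) (X : R -> R -> 'rV[R]_4) (s t : R)
    (nu : 'rV[R]_4) : R :=
  let E := dot (pd1 X s t) (pd1 X s t) in
  let F := dot (pd1 X s t) (pd2 X s t) in
  let G := dot (pd2 X s t) (pd2 X s t) in
  let e := dot (tproj (X s t) (pd1 (pd1 X) s t)) nu in
  let f := dot (tproj (X s t) (pd2 (pd1 X) s t)) nu in
  let g := dot (tproj (X s t) (pd2 (pd2 X) s t)) nu in
  (e * G - 2 * f * F + g * E) / (2 * (E * G - F ^+ 2)).

Definition minimal_on (R : realType) (I J : set R)
    (X : R -> R -> 'rV[R]_4) : Prop :=
  forall s t nu, I s -> J t -> is_unit_normal X s t nu ->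
    mean_curvature X s t nu = 0.

Definition translation_param (R : realType) (alpha beta : R -> 'rV[R]_4)
    (s t : R) : 'rV[R]_4 := qmul (alpha s) (beta t).

Definition translation_surface (R : realType) (I J : set R)
    (alpha beta : R -> 'rV[R]_4) : Prop :=
  [/\ arclength_curve I alpha, arclength_curve J beta
    & forall s t, I s -> J t -> regular_at (translation_param alpha beta) s t].

(* Main.v *)
(* Write alpha' = alpha xi and beta' = eta beta with xi, eta unit imaginary
   quaternions. In the left-invariant frame the torsion of alpha enters as
   tau - 1, so for tau = 1 the curve xi runs along a great circle. For fixed t,
   minimality says that a cubic polynomial in <xi, eta>, plus a linear form in xi,
   plus a nonzero multiple of <xi x xi', eta>, vanishes along that circle. The
   third harmonic forces eta to be orthogonal to the plane of the circle, and then
   the constant term forces eta to lie in it, so eta = 0, contradicting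
   |eta| = 1. *)
Require Import Defs.
From HB Require Import structures.
From mathcomp Require Import all_boot all_order all_algebra.
From mathcomp Require Import all_classical all_reals all_analysis.
From mathcomp Require Import ring lra.
Import Order.TTheory GRing.Theory Num.Theory.
Import numFieldNormedType.Exports.
Local Open Scope classical_set_scope.
Local Open Scope ring_scope.

(** * Explicit determinants of orders two and three *)

Lemma det2E (R : comNzRingType) (M : 'M[R]_2) :
  \det M = M 0 0 * M 1 1 - M 0 1 * M 1 0.
Proof.
rewrite (expand_det_row _ 0) !big_ord_recr big_ord0 /= /cofactor !det_mx11 !mxE /=.
rewrite expr0 expr1 add0r mul1r mulN1r mulrN.
by congr (M _ _ * M _ _ - M _ _ * M _ _); apply: val_inj.
Qed.

Lemma det3E (R : comNzRingType) (M : 'M[R]_3) :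
  \det M = M 0 0 * (M 1 1 * M 2 2 - M 1 2 * M 2 1)
    - M 0 1 * (M 1 0 * M 2 2 - M 1 2 * M 2 0)
    + M 0 2 * (M 1 0 * M 2 1 - M 1 1 * M 2 0).
Proof.
rewrite (expand_det_row _ 0) !big_ord_recr big_ord0 /= /cofactor !det2E !mxE /=.
rewrite expr0 expr1 expr2 add0r mul1r !mulN1r opprK mul1r mulrN.
by congr (M _ _ * (M _ _ * M _ _ - M _ _ * M _ _)
  - M _ _ * (M _ _ * M _ _ - M _ _ * M _ _)
  + M _ _ * (M _ _ * M _ _ - M _ _ * M _ _)); apply: val_inj.
Qed.

Section TranslationSurfaces.
Set Implicit Arguments.
Unset Strict Implicit.
Variable R : realType.
Implicit Types (u v w z p q : 'rV[R]_4) (c s t : R) (I J : set R).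

(** * Dot product and quaternion algebra in coordinates *)

Lemma rowP4 (u v : 'rV[R]_4) :
  u 0 0 = v 0 0 -> u 0 1 = v 0 1 -> u 0 2 = v 0 2 -> u 0 3 = v 0 3 -> u = v.
Proof.
move=> h0 h1 h2 h3; apply/rowP => -[[|[|[|[|//]]]] lti].
- by rewrite (_ : Ordinal lti = 0) //; apply: val_inj.
- by rewrite (_ : Ordinal lti = 1) //; apply: val_inj.
- by rewrite (_ : Ordinal lti = 2) //; apply: val_inj.
- by rewrite (_ : Ordinal lti = 3) //; apply: val_inj.
Qed.

Lemma quatE (a b c d : R) :
  (quat a b c d 0 0 = a) * (quat a b c d 0 1 = b) *
  (quat a b c d 0 2 = c) * (quat a b c d 0 3 = d).
Proof. by rewrite !mxE. Qed.

Lemma dotE (u v : 'rV[R]_4) :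
  dot u v = u 0 0 * v 0 0 + u 0 1 * v 0 1 + u 0 2 * v 0 2 + u 0 3 * v 0 3.
Proof.
rewrite /dot !big_ord_recr big_ord0 /= add0r.
by congr (u _ _ * v _ _ + u _ _ * v _ _ + u _ _ * v _ _ + u _ _ * v _ _);
  apply: val_inj.
Qed.

Lemma dotC u v : dot u v = dot v u.
Proof. by rewrite !dotE; ring. Qed.

Lemma dotDl u v w : dot (u + v) w = dot u w + dot v w.
Proof. by rewrite !dotE !mxE; ring. Qed.

Lemma dotZl c u w : dot (c *: u) w = c * dot u w.
Proof. by rewrite !dotE !mxE; ring. Qed.

Lemma dotNl u w : dot (- u) w = - dot u w.
Proof. by rewrite !dotE !mxE; ring. Qed.

Lemma dotDr u v w : dot w (u + v) = dot w u + dot w v.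
Proof. by rewrite !(dotC w) dotDl. Qed.

Lemma dotZr c u w : dot w (c *: u) = c * dot w u.
Proof. by rewrite !(dotC w) dotZl. Qed.

Lemma dotNr u w : dot w (- u) = - dot w u.
Proof. by rewrite !(dotC w) dotNl. Qed.

Definition dot_linl := (dotDl, dotZl, dotNl).

Definition dot_lin := (dot_linl, dotDr, dotZr, dotNr).

Lemma dot0r (u : 'rV[R]_4) : dot u 0 = 0.
Proof. by rewrite dotE !mxE; ring. Qed.

Lemma dot_eq0 (u : 'rV[R]_4) : dot u u = 0 -> u = 0.
Proof.
move=> /eqP; rewrite dotE -!expr2 !paddr_eq0 ?addr_ge0 ?sqr_ge0 // !sqrf_eq0.
by move=> /andP[/andP[/andP[/eqP ? /eqP ?] /eqP ?] /eqP ?];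
  apply: rowP4; rewrite mxE.
Qed.

Lemma enorm_sq (u : 'rV[R]_4) : enorm u ^+ 2 = dot u u.
Proof. by rewrite sqr_sqrtr // dotE; nra. Qed.

Lemma qmulDl u v w : qmul (u + v) w = qmul u w + qmul v w.
Proof. by apply: rowP4; rewrite /qmul !(quatE, mxE); ring. Qed.

Lemma qmulDr u v w : qmul w (u + v) = qmul w u + qmul w v.
Proof. by apply: rowP4; rewrite /qmul !(quatE, mxE) /=; ring. Qed.

Lemma qmulZl c u w : qmul (c *: u) w = c *: qmul u w.
Proof. by apply: rowP4; rewrite [RHS]mxE /qmul !quatE !mxE; ring. Qed.

Lemma qmulNl u w : qmul (- u) w = - qmul u w.
Proof. by rewrite -(scaleN1r u) qmulZl scaleN1r. Qed.

Lemma qmulZr c u w : qmul w (c *: u) = c *: qmul w u.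
Proof. by apply: rowP4; rewrite [RHS]mxE /qmul !quatE !mxE; ring. Qed.

Definition qmul_linl := (qmulDl, qmulZl, qmulNl).

Lemma qmulA u v w : qmul u (qmul v w) = qmul (qmul u v) w.
Proof. by apply: rowP4; rewrite /qmul !quatE; ring. Qed.

Lemma dot_qmull u p q : dot (qmul u p) (qmul u q) = dot u u * dot p q.
Proof. by rewrite !dotE /qmul !quatE; ring. Qed.

Lemma dot_qmulr u v p : dot (qmul u p) (qmul v p) = dot u v * dot p p.
Proof. by rewrite !dotE /qmul !quatE; ring. Qed.

(** Polarization, in both factors, of the multiplicativity of the quaternion norm. *)
Lemma dot_qmul_swap u v p q :
  dot (qmul u p) (qmul v q) + dot (qmul v p) (qmul u q) = 2 * dot u v * dot p q.
Proof. by rewrite !dotE /qmul !quatE; ring. Qed.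

Definition qconj (p : 'rV[R]_4) : 'rV[R]_4 :=
  quat (p 0 0) (- p 0 1) (- p 0 2) (- p 0 3).

Lemma dot_qmul_adjr u p q : dot (qmul u p) q = dot u (qmul q (qconj p)).
Proof. by rewrite !dotE /qmul /qconj !quatE; ring. Qed.

Lemma qmulVK (u v : 'rV[R]_4) : qmul u (qmul (qconj u) v) = dot u u *: v.
Proof.
by apply: rowP4; rewrite [RHS]mxE dotE /qmul /qconj !quatE; ring.
Qed.

Lemma dot_qconj (p : 'rV[R]_4) : dot (qconj p) (qconj p) = dot p p.
Proof. by rewrite !dotE /qconj !quatE; ring. Qed.

(** * The binormal as a quaternion product *)

(** For unit [g], write [T = g xi] and [n = g nu]: the product is then [g xi nu]. When xi and nu are
    imaginary and orthogonal, [xi nu] is their cross product, so this is the binormal. *)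
Lemma dot_binormal (g T n : 'rV[R]_4) :
  dot g g = 1 -> dot T T = 1 -> dot n n = 1 ->
  dot (qmul (qmul T (qconj g)) n) (qmul (qmul T (qconj g)) n) = 1.
Proof. by move=> gg TT nn; rewrite dot_qmulr dot_qmull dot_qconj gg TT nn !mulr1. Qed.

(** Since [g] and [T] are orthogonal, [dot_qmul_swap] exchanges them up to sign; the factor [g] then
    cancels [qconj g]. *)
Lemma dot_binormal_base (g T n p q : 'rV[R]_4) : dot g g = 1 -> dot g T = 0 ->
  dot (qmul (qmul (qmul T (qconj g)) n) p) (qmul g q)
  = - dot (qmul n p) (qmul T q).
Proof.
move=> gg gT; have := dot_qmul_swap T g (qmul (qconj g) (qmul n p)) q.
by rewrite (dotC T) gT qmulVK gg scale1r -!qmulA; lra.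
Qed.

(** Left multiplication by the unit [T] is an isometry and can be removed; that by [g] is then
    inserted. *)
Lemma dot_binormal_tangent (g T n p q : 'rV[R]_4) :
  dot g g = 1 -> dot T T = 1 ->
  dot (qmul (qmul (qmul T (qconj g)) n) p) (qmul T q)
  = dot (qmul n p) (qmul g q).
Proof.
move=> gg TT; rewrite -!qmulA dot_qmull TT -gg -dot_qmull qmulVK gg.
by rewrite scale1r.
Qed.

(** The alternating part of the triple product [v (qconj u) w] is the cross product of three vectors
    in R^4; the correction terms remove the rest. *)
Lemma det4E (u v w z : 'rV[R]_4) :
  det4 u v w z =
  dot (qmul (qmul v (qconj u)) w) z - dot u v * dot w z + dot v w * dot u z
  - dot u w * dot v z.
Proof.
(* The two sides index entries by ordinals of equal value but different form; indexing by [nat] lets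
   [ring] identify them. *)
have [F E] : exists F : 'rV[R]_4 -> nat -> R,
    forall (x : 'rV[R]_4) (j : 'I_4), x 0 j = F x j.
  by exists (fun x n => x 0 (inord n)) => x j; rewrite inord_val.
rewrite /det4 (expand_det_row _ 0) !big_ord_recr big_ord0 /= /cofactor.
rewrite !det3E !mxE /=.
rewrite !dotE /qmul /qconj !quatE !E /=.
ring.
Qed.

Lemma det4_nondeg u v w z p : det4 u v w z != 0 ->
  dot p u = 0 -> dot p v = 0 -> dot p w = 0 -> dot p z = 0 -> p = 0.
Proof.
rewrite /det4; set M := (\matrix_i _) => dM hu hv hw hz.
have uM : M \in unitmx by rewrite unitmxE unitfE.
have Mp : M *m p^T = 0.
  apply/colP => i; rewrite !mxE.
  under eq_bigr do rewrite !mxE mulrC.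
  rewrite -/(dot p _).
  by case: i => -[|[|[|[|//]]]] ?.
by apply: trmx_inj; rewrite trmx0 -(mulKmx uM p^T) Mp mulmx0.
Qed.

(** Both sides are unit vectors orthogonal to [g], [T], [n], hence equal up to sign, and the
    orientation fixes the sign. *)
Lemma binormalE (g T n b : 'rV[R]_4) :
  dot g g = 1 -> dot T T = 1 -> dot n n = 1 ->
  dot g T = 0 -> dot n g = 0 -> dot n T = 0 ->
  dot b b = 1 -> dot b g = 0 -> dot b T = 0 -> dot b n = 0 ->
  0 < det4 g T n b -> b = qmul (qmul T (qconj g)) n.
Proof.
move=> gg TT nn gT ng nT bb bg bT bn; set c := qmul _ n.
have detc z : det4 g T n z = dot c z.
  by rewrite det4E gT (dotC T n) nT (dotC g n) ng -/c; ring.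
have cc : dot c c = 1 by exact: dot_binormal.
have [cg cT cn] : [/\ dot c g = 0, dot c T = 0 & dot c n = 0].
  (* By [detc] each of these products is a determinant with a repeated row. *)
  by rewrite -!detc /det4; split;
    [rewrite (@determinant_alternate _ _ _ 0 3)
    |rewrite (@determinant_alternate _ _ _ 1 3)
    |rewrite (@determinant_alternate _ _ _ 2 3)] => // j; rewrite !mxE.
move=> db; have := db; rewrite detc => cb0.
have /eqP : c - dot c b *: b = 0.
  apply: (@det4_nondeg g T n b); rewrite ?gt_eqF //.
  1-4: by rewrite !dot_lin ?cg ?cT ?cn ?bg ?bT ?bn ?bb; ring.
rewrite subr_eq0 => /eqP cE.
have /eqP : dot c b ^+ 2 = 1.
  by rewrite -cc {3}cE dotZr expr2.
rewrite sqrf_eq1 => /orP[] /eqP e; first by rewrite cE e scale1r.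
by move: cb0; rewrite e oppr_gt0 ltr10.
Qed.

(** * Differentiation of curves and of their products *)

Lemma is_derive_rowP (n : nat) (f : R -> 'rV[R]_n) (df : 'rV[R]_n) (s : R) :
  is_derive s 1 f df <->
  forall i, is_derive s 1 (fun x => f x 0 i) (df 0 i).
Proof.
split=> [[fd <-] i|h].
  have /derivable_mxP h := fd.
  by apply: DeriveDef; [exact: h|rewrite (derive_mx fd) mxE].
have fd : derivable f s 1.
  by apply/derivable_mxP => i j; rewrite (ord1 i); have [] := h j.
apply: DeriveDef => //; rewrite (derive_mx fd); apply/rowP => i.
by rewrite mxE; have [] := h i.
Qed.

Lemma is_derive_qmul (f g : R -> 'rV[R]_4) (df dg : 'rV[R]_4) (s : R) :
  is_derive s 1 f df -> is_derive s 1 g dg ->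
  is_derive s 1 (fun x => qmul (f x) (g x)) (qmul df (g s) + qmul (f s) dg).
Proof.
move=> /is_derive_rowP hf /is_derive_rowP hg; apply/is_derive_rowP.
move=> -[[|[|[|[|//]]]] lti]; under eq_fun do rewrite mxE /=.
all: apply: is_derive_eq.
all: rewrite !mxE /GRing.scale /=; ring.
Qed.

Lemma is_derive_dot (f g : R -> 'rV[R]_4) (df dg : 'rV[R]_4) (s : R) :
  is_derive s 1 f df -> is_derive s 1 g dg ->
  is_derive s 1 (fun x => dot (f x) (g x)) (dot df (g s) + dot (f s) dg).
Proof.
move=> /is_derive_rowP hf /is_derive_rowP hg.
under eq_fun do rewrite dotE.
apply: is_derive_eq.
rewrite !dotE /GRing.scale /=; ring.
Qed.

Lemma is_derive_qmull (f : R -> 'rV[R]_4) (df p : 'rV[R]_4) s :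
  is_derive s 1 f df -> is_derive s 1 (fun x => qmul (f x) p) (qmul df p).
Proof.
move=> fd; have := is_derive_qmul fd (is_derive_cst p s 1).
by rewrite -(scale0r p) qmulZr scale0r addr0.
Qed.

Lemma is_derive_qmulr (f : R -> 'rV[R]_4) (df p : 'rV[R]_4) s :
  is_derive s 1 f df -> is_derive s 1 (fun x => qmul p (f x)) (qmul p df).
Proof.
move=> fd; have := is_derive_qmul (is_derive_cst p s 1) fd.
by rewrite -(scale0r p) qmulZl scale0r add0r.
Qed.

Lemma is_derive_dot_qmul (f g : R -> 'rV[R]_4) (df dg p q : 'rV[R]_4) s :
  is_derive s 1 f df -> is_derive s 1 g dg ->
  is_derive s 1 (fun x => dot (qmul (f x) p) (qmul (g x) q))
    (dot (qmul df p) (qmul (g s) q) + dot (qmul (f s) p) (qmul dg q)).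
Proof.
by move=> fd gd; apply: is_derive_dot; exact: is_derive_qmull.
Qed.

Lemma derive1_val (V : normedModType R) (f : R -> V) (df : V) s :
  is_derive s 1 f df -> derive1 f s = df.
Proof. by move=> [_ <-]; rewrite derive1E. Qed.

Lemma derive1_near I (V : normedModType R) (f g : R -> V) s :
  open I -> I s -> (forall x, I x -> f x = g x) -> derive1 f s = derive1 g s.
Proof.
move=> oI Is fg; rewrite !derive1E; apply: near_eq_derive.
by apply: filterS (open_nbhs_nbhs (conj oI Is)).
Qed.

Lemma derivable_derive1 (V : normedModType R) (f : R -> V) s :
  derivable f s 1 -> is_derive s 1 f (derive1 f s).
Proof. by move=> fd; rewrite derive1E; exact: DeriveDef. Qed.

Lemma derive_const_on I (f : R -> R) (c d s : R) :
  open I -> (forall x, I x -> f x = c) -> I s -> is_derive s 1 f d -> d = 0.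
Proof.
move=> oI fc Is [_ <-]; rewrite -(derive_cst c s 1); apply: near_eq_derive.
by apply: filterS (open_nbhs_nbhs (conj oI Is)).
Qed.

(** * Rigidity of a cubic relation along a harmonic oscillator *)

(* Four differentiations along the oscillator eliminate [u], [v] and [k] and
   leave two cubics in [x], [y] whose only common real zero is the origin. *)
Lemma oscillator_rigid I (C : R) (x y u v k : R -> R) :
  open I -> C != 0 ->
  (forall s, I s -> is_derive s 1 x (C * y s)) ->
  (forall s, I s -> is_derive s 1 y (- (C * x s))) ->
  (forall s, I s -> is_derive s 1 u (C * v s)) ->
  (forall s, I s -> is_derive s 1 v (- (C * u s))) ->
  (forall s, I s -> is_derive s 1 k 0) ->
  (forall s, I s -> C * k s + u s - 2 * x s + 2 * x s ^+ 3 = 0) ->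
  forall s, I s -> [/\ x s = 0, y s = 0 & k s = 0].
Proof.
move=> oI C0 hx hy hu hv hk h0.
have h1 s : I s -> v s - 2 * y s + 6 * x s ^+ 2 * y s = 0.
  move=> Is; apply: (mulfI C0); rewrite mulr0.
  apply: (derive_const_on oI h0 Is).
  have := (hx s Is, hy s Is, hu s Is, hv s Is, hk s Is) => -[[[[? ?] ?] ?] ?].
  apply: is_derive_eq; rewrite /GRing.scale /=; ring.
have h2 s : I s -> - u s + 2 * x s + 12 * x s * y s ^+ 2 - 6 * x s ^+ 3 = 0.
  move=> Is; apply: (mulfI C0); rewrite mulr0.
  apply: (derive_const_on oI h1 Is).
  have := (hx s Is, hy s Is, hu s Is, hv s Is, hk s Is) => -[[[[? ?] ?] ?] ?].
  apply: is_derive_eq; rewrite /GRing.scale /=; ring.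
have h3 s : I s -> y s ^+ 3 - 3 * x s ^+ 2 * y s = 0.
  move=> Is; have e1 := h1 s Is.
  (* Adding [h1] to the derivative of [h2] divided by [C] cancels [v] and leaves 12 times the
     goal. *)
  suff : - v s + 2 * y s + 12 * y s ^+ 3 - 42 * x s ^+ 2 * y s = 0 by lra.
  apply: (mulfI C0); rewrite mulr0.
  apply: (derive_const_on oI h2 Is).
  have := (hx s Is, hy s Is, hu s Is, hv s Is, hk s Is) => -[[[[? ?] ?] ?] ?].
  apply: is_derive_eq; rewrite /GRing.scale /=; ring.
have h4 s : I s -> x s ^+ 3 - 3 * x s * y s ^+ 2 = 0.
  move=> Is; apply: (mulfI C0).
  suff : C * (3 * (x s ^+ 3 - 3 * x s * y s ^+ 2)) = 0 by lra.
  apply: (derive_const_on oI h3 Is).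
  have := (hx s Is, hy s Is, hu s Is, hv s Is, hk s Is) => -[[[[? ?] ?] ?] ?].
  apply: is_derive_eq; rewrite /GRing.scale /=; ring.
move=> s Is; have [e0 e2 e3 e4] := And4 (h0 s Is) (h2 s Is) (h3 s Is) (h4 s Is).
(* [h3] and [h4] say that [(x + i y) ^ 3 = 0]; take the square of the modulus. *)
have : (x s ^+ 2 + y s ^+ 2) ^+ 3 = 0.
  rewrite (_ : _ ^+ 3 = (x s ^+ 3 - 3 * x s * y s ^+ 2) ^+ 2
    + (y s ^+ 3 - 3 * x s ^+ 2 * y s) ^+ 2); last by ring.
  by rewrite e3 e4; ring.
move=> /eqP; rewrite expf_eq0 /= paddr_eq0 ?sqr_ge0 // !sqrf_eq0.
move=> /andP[/eqP x0 /eqP y0]; split=> //; apply: (mulfI C0).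
(* At [x = y = 0], [e2] gives [u = 0], and then [e0] gives [C k = 0]. *)
by move: e0 e2; rewrite x0 y0; lra.
Qed.

(** * Arc length curves in the sphere and their Frenet equations *)

(** The last three products come from differentiating [<g, g> = 1], [<g, g'> = 0] and
    [<g', g'> = 1]. *)
Lemma arclength_dots I (g : R -> 'rV[R]_4) : open I -> arclength_curve I g ->
  forall s, I s ->
  [/\ is_derive s 1 g (derive1 g s), is_derive s 1 (derive1 g) (derive1 (derive1 g) s),
      is_derive s 1 (derive1 (derive1 g)) (derive1 (derive1 (derive1 g)) s) &
  [/\ dot (g s) (g s) = 1, dot (derive1 g s) (derive1 g s) = 1,
      dot (g s) (derive1 g s) = 0, dot (derive1 (derive1 g) s) (g s) = -1 &
      dot (derive1 (derive1 g) s) (derive1 g s) = 0]].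
Proof.
move=> oI [sm gS gT].
have d0 s : I s -> is_derive s 1 g (derive1 g s).
  by move=> Is; exact/derivable_derive1/(sm 0%N).
have d1 s : I s -> is_derive s 1 (derive1 g) (derive1 (derive1 g) s).
  by move=> Is; exact/derivable_derive1/(sm 1%N).
have d2 s : I s -> is_derive s 1 (derive1 (derive1 g)) (derive1 (derive1 (derive1 g)) s).
  by move=> Is; exact/derivable_derive1/(sm 2%N).
have g0 s : I s -> dot (g s) (g s) = 1.
  by move=> Is; rewrite -enorm_sq gS // expr1n.
have g1 s : I s -> dot (derive1 g s) (derive1 g s) = 1.
  by move=> Is; rewrite -enorm_sq gT // expr1n.
have g01 s : I s -> dot (g s) (derive1 g s) = 0.
  move=> Is; have := derive_const_on oI g0 Is (is_derive_dot (d0 s Is) (d0 s Is)).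
  by rewrite (dotC (derive1 g s)); lra.
move=> s Is; split; [exact: d0|exact: d1|exact: d2|split]; auto.
- have := derive_const_on oI g01 Is (is_derive_dot (d0 s Is) (d1 s Is)).
  by rewrite g1 // (dotC (g s)); lra.
- have := derive_const_on oI g1 Is (is_derive_dot (d1 s Is) (d1 s Is)).
  by rewrite (dotC (derive1 g s) (derive1 _ s)); lra.
Qed.

(** The Frenet equations for torsion 1, read in R^4: the derivative of the tangent gains the
    component [- g] normal to the sphere, and the binormal becomes an explicit product by
    [binormalE]. *)
Lemma helix_frame I (C : R) (g : R -> 'rV[R]_4) :
  open I -> C != 0 -> arclength_curve I g ->
  (forall s, I s -> curvature g s = C) -> (forall s, I s -> has_torsion g s 1) ->
  exists n : R -> 'rV[R]_4, forall s, I s ->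
  [/\ is_derive s 1 (derive1 g) (C *: n s - g s),
      is_derive s 1 n (qmul (qmul (derive1 g s) (qconj (g s))) (n s)
                       - C *: derive1 g s) &
  [/\ dot (n s) (n s) = 1, dot (n s) (g s) = 0 & dot (n s) (derive1 g s) = 0]].
Proof.
move=> oI C0 arc curv tors.
have fr := arclength_dots oI arc.
(* Agrees with [frenet_n g] on [I], but is visibly differentiable because [g] has three derivatives
   there. *)
pose n s := C^-1 *: (derive1 (derive1 g) s + g s).
have covE s : I s -> covD g (derive1 g) s = derive1 (derive1 g) s + g s.
  by move=> Is; have [_ _ _ [_ _ _ e _]] := fr s Is;
    rewrite /covD /tproj e scaleN1r opprK.
have nE s : I s -> frenet_n g s = n s.
  by move=> Is; rewrite /frenet_n curv // covE.
have nn s : I s -> dot (n s) (n s) = 1.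
  move=> Is; have := curv s Is; rewrite /curvature covE // => cE.
  by rewrite dotZl dotZr -enorm_sq cE; field.
have ng s : I s -> dot (n s) (g s) = 0.
  by move=> Is; have [_ _ _ [gg _ _ e _]] := fr s Is;
    rewrite dotZl dotDl e gg addNr mulr0.
have nT s : I s -> dot (n s) (derive1 g s) = 0.
  by move=> Is; have [_ _ _ [_ _ e _ e']] := fr s Is;
    rewrite dotZl dotDl e e' addr0 mulr0.
have dn s : I s -> derivable n s 1.
  by move=> Is; have [dg _ d2 _] := fr s Is; apply: ex_derive.
exists n => s Is; have [dg dT d2 [gg TT gT _ _]] := fr s Is.
split; last by split; auto.
  by apply: is_derive_eq dT _; rewrite scalerA mulfV // scale1r addrK.
have dns := derivable_derive1 (dn s Is).
have [_ [b [b1 bg bT bn db]]] := tors s Is.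
have nn' : derive1 (frenet_n g) s = derive1 n s by exact: derive1_near nE.
(* The derivative of [n] is already tangent to the sphere, so [covD] is here the ordinary
   derivative. *)
have n'g : dot (derive1 n s) (g s) = 0.
  have := derive_const_on oI ng Is (is_derive_dot dns dg).
  by rewrite nT //; lra.
rewrite /covD /tproj nn' n'g scale0r subr0 curv // scale1r => n'E.
apply: is_derive_eq dns _; rewrite n'E addrC; congr (_ - _).
have bb : dot b b = 1 by rewrite -enorm_sq b1 expr1n.
move: bn db; rewrite nE // => bn db.
by apply: binormalE => //; auto.
Qed.

(** * The minimal surface equation of a translation surface *)

(* [xst + F *: x] is an unnormalized normal; it vanishes exactly where [xs] and
   [xt] are dependent, in which case the identity is trivial. *)
Lemma minimal_vectors (x xs xt xss xst xtt : 'rV[R]_4) (F : R) :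
  dot x x = 1 -> dot xs xs = 1 -> dot xt xt = 1 -> dot xs xt = F ->
  dot x xs = 0 -> dot x xt = 0 ->
  dot xst xst = 1 -> dot xst x = - F -> dot xst xs = 0 -> dot xst xt = 0 ->
  (forall nu, [/\ enorm nu = 1, dot nu x = 0, dot nu xs = 0 & dot nu xt = 0] ->
    (dot (tproj x xss) nu - 2 * dot (tproj x xst) nu * F
     + dot (tproj x xtt) nu) / (2 * (1 - F ^+ 2)) = 0) ->
  dot xss (xst + F *: x) + dot xtt (xst + F *: x) - 2 * F * (1 - F ^+ 2) = 0.
Proof.
move=> xx ss tt st xs0 xt0 qq qx qs qt minX.
have [W WE] : exists W, W = xst + F *: x by exists (xst + F *: x).
rewrite -WE.
have Wx : dot W x = 0 by rewrite WE dotDl dotZl xx qx mulr1 addNr.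
have Ws : dot W xs = 0 by rewrite WE dotDl dotZl xs0 qs mulr0 addr0.
have Wt : dot W xt = 0 by rewrite WE dotDl dotZl xt0 qt mulr0 addr0.
have qW : dot xst W = 1 - F ^+ 2.
  by rewrite WE dotDr dotZr qq qx mulrN expr2.
have WW : dot W W = 1 - F ^+ 2.
  by rewrite {1}WE dotDl dotZl qW (dotC x) Wx mulr0 addr0.
have [G0|G0] := eqVneq (1 - F ^+ 2) 0.
  have W0 : W = 0 by apply: dot_eq0; rewrite WW.
  by rewrite W0 !dot0r G0 mulr0 addr0 subr0.
have W0 : enorm W != 0.
  by apply: contraNneq G0 => W0; rewrite -WW -enorm_sq W0 expr0n.
have nuE : enorm ((enorm W)^-1 *: W) = 1.
  have : enorm ((enorm W)^-1 *: W) ^+ 2 = 1.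
    by rewrite enorm_sq dotZl dotZr -enorm_sq; field.
  by move=> /eqP; rewrite sqrp_eq1 ?sqrtr_ge0 // => /eqP.
have tprojE v : dot (tproj x v) ((enorm W)^-1 *: W) = (enorm W)^-1 * dot v W.
  by rewrite /tproj dotZr dotDl dotNl dotZl (dotC x) Wx mulr0 subr0.
have := minX ((enorm W)^-1 *: W).
(* With the normalized [W] as normal, the mixed coefficient is [(1 - F ^+ 2) / enorm W], so the
   numerator of the mean curvature is the goal divided by [enorm W]. *)
rewrite !tprojE qW !dotZl Wx Ws Wt !mulr0 => /(_ (And4 nuE erefl erefl erefl)) /eqP.
rewrite mulf_eq0 invr_eq0 mulf_eq0 pnatr_eq0 (negPf G0) orbF /= orbF => /eqP H.
by apply: (mulfI (invr_neq0 W0)); rewrite mulr0 -H; ring.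
Qed.

(** Multiplication by unit quaternions is isometric, so [E = G = 1], and the mixed derivative
    [a' b'] is a unit vector orthogonal to both [a' b] and [a b']; its component along [a b] is
    [- F] by [dot_qmul_swap]. This is the setting of [minimal_vectors]. *)
Lemma minimal_translation_eq I J (a b : R -> 'rV[R]_4) s t :
  open I -> open J -> translation_surface I J a b ->
  minimal_on I J (translation_param a b) -> I s -> J t ->
  let F := dot (qmul (derive1 a s) (b t)) (qmul (a s) (derive1 b t)) in
  let W := qmul (derive1 a s) (derive1 b t) + F *: qmul (a s) (b t) in
  dot (qmul (derive1 (derive1 a) s) (b t)) W
  + dot (qmul (a s) (derive1 (derive1 b) t)) W - 2 * F * (1 - F ^+ 2) = 0.
Proof.
move=> oI oJ [aI bJ _] minX Is Jt /=.
have fa := arclength_dots oI aI; have fb := arclength_dots oJ bJ.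
have [da dT _ [aa TT aT _ _]] := fa s Is.
have [db dU _ [bb UU bU _ _]] := fb t Jt.
pose X := translation_param a b.
have X1 t' s' : I s' -> pd1 X s' t' = qmul (derive1 a s') (b t').
  by move=> /fa[d _ _ _]; apply/derive1_val/is_derive_qmull.
have X2 s' t' : J t' -> pd2 X s' t' = qmul (a s') (derive1 b t').
  by move=> /fb[d _ _ _]; apply/derive1_val/is_derive_qmulr.
have X11 : pd1 (pd1 X) s t = qmul (derive1 (derive1 a) s) (b t).
  rewrite /pd1 (derive1_near (g := fun s' => qmul (derive1 a s') (b t)) oI Is).
    exact/derive1_val/is_derive_qmull.
  by move=> s' Is'; exact: X1.
have X12 : pd2 (pd1 X) s t = qmul (derive1 a s) (derive1 b t).
  rewrite /pd2 (derive1_near (g := fun t' => qmul (derive1 a s) (b t')) oJ Jt).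
    exact/derive1_val/is_derive_qmulr.
  by move=> t' _; rewrite X1.
have X22 : pd2 (pd2 X) s t = qmul (a s) (derive1 (derive1 b) t).
  rewrite /pd2 (derive1_near (g := fun t' => qmul (a s) (derive1 b t')) oJ Jt).
    exact/derive1_val/is_derive_qmulr.
  by move=> t' Jt'; exact: X2.
have := minX s t.
rewrite /is_unit_normal /mean_curvature X11 X12 X22 (X1 t s Is) (X2 s t Jt).
have -> : translation_param a b s t = qmul (a s) (b t) by [].
rewrite !dot_qmulr TT UU aa bb !mulr1.
move: da dT db dU X1 X2 X11 X12 X22 => _ _ _ _ _ _ _ _ _ {}minX.
have Ta : dot (derive1 a s) (a s) = 0 by rewrite dotC.
have Ub : dot (derive1 b t) (b t) = 0 by rewrite dotC.
apply: (@minimal_vectors _ (qmul (derive1 a s) (b t)) (qmul (a s) (derive1 b t))).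
- by rewrite dot_qmull aa bb mulr1.
- by rewrite dot_qmull TT bb mulr1.
- by rewrite dot_qmull aa UU mulr1.
- by [].
- by rewrite dot_qmulr aT mul0r.
- by rewrite dot_qmull bU mulr0.
- by rewrite dot_qmull TT UU mulr1.
- have := dot_qmul_swap (derive1 a s) (a s) (derive1 b t) (b t).
  rewrite Ta mulr0 mul0r (dotC (qmul (a s) _)).
  by move/eqP; rewrite addr_eq0 => /eqP.
- by rewrite dot_qmull Ub mulr0.
- by rewrite dot_qmulr Ta mul0r.
- by move=> nu nuN; have := minX nu Is Jt nuN; rewrite !mulr1.
Qed.

End TranslationSurfaces.

(** * Reduction of nonexistence to the oscillator *)

Theorem theorem6p1 (R : realType) (I J : set R) (C : R) :
  open_interval I -> open_interval J -> C != 0 ->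
  ~ (exists alpha beta : R -> 'rV[R]_4,
       [/\ translation_surface I J alpha beta,
           minimal_on I J (translation_param alpha beta),
           forall s, I s -> curvature alpha s = C
         & forall s, I s -> has_torsion alpha s 1]).
Proof.
move=> [oI _ [s0 Is0]] [oJ _ [t Jt]] C0 [a [b [surf minX curv tors]]].
have [aI bJ _] := surf.
have fa := arclength_dots oI aI.
have [n fn] := helix_frame oI C0 aI curv tors.
have [_ _ _ [pp qq pq rp rq]] := arclength_dots oJ bJ Jt.
have eqn s Is := @minimal_translation_eq R I J a b s t oI oJ surf minX Is Jt.
move: pp qq pq rp rq eqn.
(* With [t] fixed, beta enters only through three constant vectors and their dot products. *)
set p := b t; set q := derive1 b t; set r := derive1 (derive1 b) t.
clearbody p q r => pp qq pq rp rq eqn.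
pose T := derive1 a.
pose c s := qmul (qmul (T s) (qconj (a s))) (n s).
have frame s : I s -> [/\ is_derive s 1 a (T s),
   is_derive s 1 T (C *: n s - a s), is_derive s 1 n (c s - C *: T s),
   dot (a s) (a s) = 1 &
   [/\ dot (T s) (T s) = 1, dot (n s) (n s) = 1,
   dot (a s) (T s) = 0, dot (n s) (a s) = 0 & dot (n s) (T s) = 0]].
  by move=> Is; have [d1 _ _ [? ? ? _ _]] := fa s Is;
     have [d2 d3 [? ? ?]] := fn s Is.
(* With nu = alpha^-1 n: x = <xi, eta>, y = <nu, eta>, k = - <xi x nu, eta>,
   u = <xi, eta x eta'>, v = <nu, eta x eta'>. *)
pose x s := dot (qmul (T s) p) (qmul (a s) q).
pose y s := dot (qmul (n s) p) (qmul (a s) q).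
pose k s := dot (qmul (n s) p) (qmul (T s) q).
pose u s := dot (qmul (T s) q) (qmul (a s) (p + r)).
pose v s := dot (qmul (n s) q) (qmul (a s) (p + r)).
(* Torsion 1 acts here: in the derivatives of [y] and [v] the binormal part of [n'] cancels the term
   from [alpha' = T], leaving a harmonic oscillator. Likewise [cTE] makes [k] constant. *)
have caE s z w : I s ->
    dot (qmul (c s) z) (qmul (a s) w) = - dot (qmul (n s) z) (qmul (T s) w).
  by move=> /frame[_ _ _ aa [_ _ aT _ _]]; exact: dot_binormal_base.
have cTE s : I s -> dot (qmul (c s) p) (qmul (T s) q) = y s.
  by move=> /frame[_ _ _ aa [TT _ _ _ _]]; exact: dot_binormal_tangent.
have Tap s : I s -> dot (qmul (a s) p) (qmul (T s) q) = - x s.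
  move=> /frame[_ _ _ aa [_ _ aT _ _]].
  by have := dot_qmul_swap (a s) (T s) p q; rewrite aT -/(x s); lra.
have [] : [/\ x s0 = 0, y s0 = 0 & k s0 = 0].
  apply: (@oscillator_rigid R I C x y u v k) => // s Is;
  have [da dT dn aa [TT nn aT na nT]] := frame s Is.
  - apply: is_derive_eq (is_derive_dot_qmul p q dT da) _.
    rewrite !(qmul_linl, dot_lin) !dot_qmull pq -/(y s); ring.
  - apply: is_derive_eq (is_derive_dot_qmul p q dn da) _.
    rewrite !(qmul_linl, dot_lin) caE // -/(x s) -/(k s); ring.
  - apply: is_derive_eq (is_derive_dot_qmul q (p + r) dT da) _.
    rewrite !(qmul_linl, dot_linl) -/(v s).
    by rewrite !dot_qmull aa TT; ring.
  - apply: is_derive_eq (is_derive_dot_qmul q (p + r) dn da) _.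
    rewrite !(qmul_linl, dot_linl) caE //.
    by rewrite -/(u s); ring.
  - apply: is_derive_eq (is_derive_dot_qmul p q dn dT) _.
    rewrite !(qmul_linl, dot_lin).
    by rewrite cTE // -/(y s) !dot_qmull pq; ring.
  - have /= := eqn s Is; rewrite (derive1_val dT) -/T -/(x s).
    have na' : dot (qmul (n s) p) (qmul (a s) p) = 0 by rewrite dot_qmulr na mul0r.
    rewrite !(qmul_linl, dot_lin).
    (* The first product of [minimal_translation_eq] reduces to [C k], the second to [u]: the
       summand [p] of [p + r] absorbs the remaining terms [x]. *)
    rewrite na' Tap // -/(k s) !dot_qmull aa pp rp /u qmulDr dotDr.
    by rewrite (dotC _ (qmul (a s) p)) Tap // (dotC (qmul (a s) r)); lra.
move=> x0 y0 k0.
have [da dT dn aa [TT nn aT na nT]] := frame s0 Is0.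
have cc : dot (c s0) (c s0) = 1 by exact: dot_binormal.
(* [pq], [x0], [y0] and [k0] make this vector orthogonal to the whole frame [a], [T], [n], [c],
   whose determinant is 1; yet it is a product of unit quaternions. *)
have aB : qmul (qmul (a s0) q) (qconj p) = 0.
  apply: (@det4_nondeg _ (a s0) (T s0) (n s0) (c s0)).
  - rewrite det4E -/(c s0) cc aT (dotC (T s0)) nT (dotC (a s0) (n s0)) na.
    by rewrite !mul0r !subr0 addr0 oner_neq0.
  1-4: rewrite dotC -dot_qmul_adjr //.
  - by rewrite dot_qmull pq mulr0.
  - by rewrite caE // -/(k s0) k0 oppr0.
have := congr1 (fun z => dot z z) aB.
rewrite dot_qmulr dot_qmull dot_qconj aa qq pp dot0r !mulr1.
by move/eqP; rewrite oner_eq0.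
Qed.
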